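(* (a) The theory of the random graph is dfs-trivial. (b) The theory of the random bipartite graph, in the language $\{E,P,Q\}$, is dfs-trivial.
   Context: The random graph is the Fraïssé limit of the class of finite graphs. The random bipartite graph is the Fraïssé limit of the class of finite bipartite graphs in the language $\{E,P,Q\}$, where $E$ is the edge relation and $P,Q$ are unary predicates for the bipartition. A complete one-sorted theory is dfs-trivial if, for every $n\ge1$, every global Keisler measure in $n$ variables that is definable over and finitely satisfiable in some small model is trivial, i.e. of the form $\sum_k r_k\delta_{a_k}$ with $a_k$ in the monster model, $r_k\in[0,1]$, $\sum_k r_k=1$, and $\delta_a$ the Dirac measure at $a$. *)

(* Defs.v *)
From HB Require Import structures.
From mathcomp Require Import all_boot all_order all_algebra.
From mathcomp Require Import all_classical all_reals all_analysis.
Set Implicit Arguments.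
Unset Strict Implicit.
Unset Printing Implicit Defensive.
Import Order.TTheory GRing.Theory Num.Theory.
Import numFieldNormedType.Exports.
Local Open Scope classical_set_scope.
Local Open Scope ring_scope.

(* All languages are one-sorted and relational (with equality), which covers
   {E} and {E, P, Q}. *)

Record language := Language {
  symbol : Type;
  arity : symbol -> nat }.

Record structure (L : language) := Structure {
  carrier :> Type;
  interp : forall s : symbol L, (arity s).-tuple carrier -> Prop }.

Arguments interp {L} _ _ _.

(* [formula L V] is the type of L-formulas with free variables in V; a
   quantifier binds the variable [None] of [option V]. L-sentences have V empty.
   Parameters are handled as variables whose value is fixed: an L_x(A)-formula,
   x an n-tuple of variables and A a set of parameters, is a
   [formula L ('I_n + A)]. *)
Inductive formula (L : language) (V : Type) : Type :=
| fbot
| feq of V & V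
| frel (s : symbol L) of (arity s).-tuple V
| fimp of formula L V & formula L V
| fall of formula L (option V).

Arguments fbot {L V}.
Arguments feq {L V} _ _.
Arguments frel {L V} _ _.
Arguments fimp {L V} _ _.
Arguments fall {L V} _.

Definition fnot L (V : Type) (phi : formula L V) : formula L V := fimp phi fbot.
Definition ftop L (V : Type) : formula L V := fnot fbot.
Definition for_ L (V : Type) (phi psi : formula L V) : formula L V :=
  fimp (fnot phi) psi.

Arguments ftop {L V}.

Fixpoint frename L (V W : Type) (f : V -> W) (phi : formula L V) : formula L W :=
  match phi with
  | fbot => fbot
  | feq x y => feq (f x) (f y)
  | frel s t => frel s (map_tuple f t)
  | fimp phi1 phi2 => fimp (frename f phi1) (frename f phi2)
  | fall phi1 => fall (frename (omap f) phi1)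
  end.

Fixpoint sat L (M : structure L) (V : Type) (phi : formula L V) (v : V -> M) : Prop :=
  match phi with
  | fbot => False
  | feq x y => v x = v y
  | frel s t => interp M s (map_tuple v t)
  | fimp phi1 phi2 => sat phi1 v -> sat phi2 v
  | fall phi1 => forall a : M, sat phi1 (oapp v a)
  end.

Definition sentence (L : language) := formula L void.

Definition models L (M : structure L) (phi : sentence L) : Prop :=
  sat phi (of_void M).

Definition Th L (M : structure L) : set (sentence L) := [set phi | models M phi].

Definition model_of L (T : set (sentence L)) (M : structure L) : Prop :=
  T `<=` Th M.

Definition substructure L (M : structure L) (A : set M) : structure L :=
  @Structure L (set_type A) (fun s t => interp M s (map_tuple val t)).

Definition embedding L (A B : structure L) (f : A -> B) : Prop :=
  injective f /\
  forall (s : symbol L) (t : (arity s).-tuple A),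
    interp A s t <-> interp B s (map_tuple f t).

Definition automorphism L (M : structure L) (g : M -> M) : Prop :=
  bijective g /\ embedding g.

(* A and its ambient structure agree on all L_A-sentences. *)
Definition elementary_substructure L (M : structure L) (A : set M) : Prop :=
  forall phi : formula L (set_type A),
    sat (M := substructure A) phi id <-> sat (M := M) phi val.

Definition elementary_map L (M : structure L) (A : set M) (f : set_type A -> M)
  : Prop := forall phi : formula L (set_type A), sat phi val <-> sat phi f.

(* Finitely generated substructures are the finite ones, since languages are
   relational. *)
Definition ultrahomogeneous L (M : structure L) : Prop :=
  forall (A : set M) (f : substructure A -> M), finite_set A -> embedding f ->
    exists2 g : M -> M, automorphism g & forall a, g (val a) = f a.

Definition fraisse_limit L (K : structure L -> Prop) (M : structure L) : Prop :=
  [/\ countable [set: M],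
      ultrahomogeneous M &
      forall A : structure L, finite_set [set: A] ->
        ((exists f : A -> M, embedding f) <-> K A)].

Definition card_lt (T U : Type) (A : set T) (B : set U) : Prop :=
  (A #<= B)%card /\ ~ (B #<= A)%card.

(* Smallness is relative to the cardinal of the type K. *)
Definition small (K T : Type) (A : set T) : Prop := card_lt A [set: K].

Section types.
Context {L : language} {U : structure L}.
Implicit Types (A : set U) (n : nat).

(* The valuation of the variables x by a, parameters standing for themselves. *)
Definition val_at A n (a : 'I_n -> U) (i : 'I_n + set_type A) : U :=
  match i with inl j => a j | inr c => val c end.

Definition complete_type A n (p : set (formula L ('I_n + set_type A))) : Prop :=
  (forall F, finite_set F -> F `<=` p ->
     exists a : 'I_n -> U, forall psi, F psi -> sat psi (val_at a)) /\
  (forall psi, p psi \/ p (fnot psi)).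

(* S_n(A) *)
Definition type_space A n :=
  {p : set (formula L ('I_n + set_type A)) | complete_type p}.

Lemma complete_type_tp A n (b : 'I_n -> U) :
  complete_type [set psi : formula L ('I_n + set_type A) | sat psi (val_at b)].
Proof.
split=> [F _ Fb|psi /=]; first by exists b => psi /Fb.
exact: EM.
Qed.

Definition tp A n (b : 'I_n -> U) : type_space A n :=
  exist _ _ (complete_type_tp A b).

HB.instance Definition _ A n := gen_eqMixin (type_space A n).
HB.instance Definition _ A n := gen_choiceMixin (type_space A n).

(* The Stone topology. *)
Definition basic_clopen A n (psi : formula L ('I_n + set_type A)) :
  set (type_space A n) := [set p | sval p psi].

HB.instance Definition _ A n := isSubBaseTopological.Build (type_space A n)
  (range (@basic_clopen A n)) id.

End types.

Definition saturated (K : Type) L (U : structure L) : Prop :=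
  forall (A : set U) (n : nat) (p : type_space A n), small K A ->
    exists a : 'I_n -> U, forall psi, sval p psi -> sat psi (val_at a).

Definition strongly_homogeneous (K : Type) L (U : structure L) : Prop :=
  forall (A : set U) (f : set_type A -> U), small K A -> elementary_map f ->
    exists2 g : U -> U, automorphism g & forall a, g (val a) = f a.

(* U is a monster model of T, with "small" meaning of cardinality < |K|, where
   |K| > |L| + aleph_0. *)
Definition monster (K : Type) L (T : set (sentence L)) (U : structure L)
  : Prop :=
  [/\ card_lt [set: symbol L + nat] [set: K],
      model_of T U,
      saturated K U &
      strongly_homogeneous K U].

(* An L_x(U)-formula is evaluated at a by letting parameters denote
   themselves. *)
Definition sat_at L (U : structure L) n (phi : formula L ('I_n + U))
  (a : 'I_n -> U) : Prop :=
  sat phi (fun i => match i with inl j => a j | inr c => c end).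

(* The formula phi(x, b). *)
Definition finst L (U : structure L) n m (phi : formula L ('I_n + 'I_m))
  (b : 'I_m -> U) : formula L ('I_n + U) :=
  frename (fun i => match i with inl j => inl j | inr k => inr (b k) end) phi.

(* Finitely additive probability measures on the Boolean algebra of
   L_x(U)-formulas modulo equivalence in U, x an n-tuple of variables. *)
Record keisler_measure (R : realType) L (U : structure L) (n : nat) :=
  KeislerMeasure {
  kmeas :> formula L ('I_n + U) -> R;
  kmeas_equiv : forall phi psi,
    (forall a, sat_at phi a <-> sat_at psi a) -> kmeas phi = kmeas psi;
  kmeas_ge0 : forall phi, 0 <= kmeas phi;
  kmeas_top : kmeas ftop = 1;
  kmeas_additive : forall phi psi,
    (forall a, ~ (sat_at phi a /\ sat_at psi a)) ->
    kmeas (for_ phi psi) = kmeas phi + kmeas psi }.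

Section measures.
Context {R : realType} {L : language} {U : structure L} {n : nat}.
Implicit Types (mu : keisler_measure R U n) (A : set U).

(* For every phi(x, y), mu(phi(x, b)) depends only on tp(b / A) (that is, mu is
   A-invariant), and the induced function S_y(A) -> R is continuous. *)
Definition definable_over mu A : Prop :=
  forall (m : nat) (phi : formula L ('I_n + 'I_m)),
    exists2 F : type_space A m -> R,
      continuous F & forall b : 'I_m -> U, F (tp A b) = mu (finst phi b).

Definition finitely_satisfiable_in mu A : Prop :=
  forall phi, 0 < mu phi ->
    exists2 a : 'I_n -> U, (forall i, A (a i)) & sat_at phi a.

Definition dfs (K : Type) mu : Prop :=
  exists A : set U,
    [/\ small K A, elementary_substructure A, definable_over mu A &
        finitely_satisfiable_in mu A].

Definition dirac_at (a : 'I_n -> U) (phi : formula L ('I_n + U)) : R :=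
  `[< sat_at phi a >]%:R.

(* Finite sums are those with r k = 0 for all large k. *)
Definition trivial_measure mu : Prop :=
  exists (a : nat -> 'I_n -> U) (r : nat -> R),
    [/\ forall k, 0 <= r k <= 1,
        series r @ \oo --> (1 : R) &
        forall phi, series (fun k => r k * dirac_at (a k) phi) @ \oo --> mu phi].

End measures.

(* Quantifying over all monster models makes the notion independent of the
   choice of one. *)
Definition dfs_trivial (R : realType) L (T : set (sentence L)) : Prop :=
  forall (K : Type) (U : structure L), monster K T U ->
  forall n : nat, (1 <= n)%N ->
  forall mu : keisler_measure R U n, dfs K mu -> trivial_measure mu.

Inductive graph_symbol := graph_E.

Definition graph_language : language :=
  @Language graph_symbol (fun _ => 2%N).

Definition finite_graph (A : structure graph_language) : Prop :=
  let E (x y : A) := interp A graph_E [tuple x; y] in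
  [/\ finite_set [set: A],
      forall x, ~ E x x &
      forall x y, E x y -> E y x].

Inductive bipartite_symbol := bip_E | bip_P | bip_Q.

Definition bipartite_language : language :=
  @Language bipartite_symbol
    (fun s => match s with bip_E => 2%N | bip_P | bip_Q => 1%N end).

(* P and Q partition the vertices, and every edge joins P and Q; in particular
   there are no loops. *)
Definition finite_bipartite_graph (A : structure bipartite_language) : Prop :=
  let E (x y : A) := interp A bip_E [tuple x; y] in
  let P (x : A) := interp A bip_P [tuple x] in
  let Q (x : A) := interp A bip_Q [tuple x] in
  [/\ finite_set [set: A],
      forall x, (P x \/ Q x) /\ ~ (P x /\ Q x),
      forall x y, E x y -> E y x &
      forall x y, E x y -> (P x /\ Q y) \/ (Q x /\ P y)].

(* The Fraisse limit of a class, when it exists, is unique up to isomorphism;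
   these predicates describe its isomorphism class. *)
Definition random_graph (G : structure graph_language) : Prop :=
  fraisse_limit finite_graph G.

Definition random_bipartite_graph (G : structure bipartite_language) : Prop :=
  fraisse_limit finite_bipartite_graph G.

(* Main.v *)
(* A measure definable over and finitely satisfiable in A is tight on each
   coordinate x_i: for every eps > 0 some finite F satisfies mu(x_i notin F) < eps.
   For the random graph, saturation gives b outside A with no neighbour in A, and
   then mu(E(x_i, b)) = 0 by finite satisfiability. By continuity of
   tp(b'/A) |-> mu(E(x_i, b')) and quantifier elimination there is a finite F in A
   such that mu(E(x_i, b')) < eps whenever b' and b have the same neighbours in F.
   Choosing such a b' adjacent to all of A \ F, finite satisfiability gives
   mu(x_i notin F) <= mu(E(x_i, b')) < eps. The bipartite case is the same, one
   side of the bipartition at a time. A measure that is tight on every coordinate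
   lives on countably many points. *)
Require Import Defs.
From HB Require Import structures.
From mathcomp Require Import all_boot all_order all_algebra finmap.
From mathcomp Require Import all_classical all_reals all_analysis.
From mathcomp Require Import lra.
Set Implicit Arguments.
Unset Strict Implicit.
Unset Printing Implicit Defensive.
Import Order.TTheory GRing.Theory Num.Theory.
Import numFieldNormedType.Exports.
Local Open Scope classical_set_scope.
Local Open Scope ring_scope.

(** * Renaming of variables and derived connectives *)

Lemma map_tuple_comp (A B C : Type) n (f : B -> C) (g : A -> B)
    (t : n.-tuple A) :
  map_tuple f (map_tuple g t) = map_tuple (f \o g) t.
Proof. by apply: val_inj; rewrite /= -map_comp. Qed.

Lemma sat_frename L (M : structure L) (V W : Type) (f : V -> W)
    (phi : formula L V) (v : W -> M) :
  sat (frename f phi) v = sat phi (v \o f).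
Proof.
elim: phi W f v => [|//|{}V s t|{}V phi IH psi IH'|{}V phi IH] W f v //=.
- by rewrite map_tuple_comp.
- by rewrite IH IH'.
- apply: eq_forall => a; rewrite IH; congr sat.
  by apply/funext => -[].
Qed.

Definition fand L (V : Type) (phi psi : formula L V) : formula L V :=
  fnot (fimp phi (fnot psi)).

Definition fexists L (V : Type) (phi : formula L (option V)) : formula L V :=
  fnot (fall (fnot phi)).

Definition fconj L (V I : Type) (g : I -> formula L V) (s : seq I) :
    formula L V :=
  foldr (fun i => fand (g i)) ftop s.

Section connectives.
Context {L : language} {M : structure L} {V : Type}.
Implicit Types (v : V -> M) (phi psi : formula L V).

Lemma sat_fand phi psi v : sat (fand phi psi) v <-> sat phi v /\ sat psi v.
Proof.
split=> [h|[h h'] /(_ h)/(_ h')//].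
by split; apply: contrapT => nh; apply: h => // h h'.
Qed.

Lemma sat_for phi psi v : sat (for_ phi psi) v <-> sat phi v \/ sat psi v.
Proof.
split=> [h|[h nh|h nh //]]; last by case: (nh h).
by have [|nh] := EM (sat phi v); [left|right; exact: h].
Qed.

Lemma sat_fexists (phi : formula L (option V)) v :
  sat (fexists phi) v <-> exists a, sat phi (oapp v a).
Proof.
split=> [h|[a h] /(_ a)/(_ h)//].
by apply: contrapT => nh; apply: h => a ha; apply: nh; exists a.
Qed.

Lemma sat_fconj (I : eqType) (g : I -> formula L V) (s : seq I) v :
  sat (fconj g s) v <-> forall i, i \in s -> sat (g i) v.
Proof.
elim: s => [|j s IH]; first by split=> [_ i|_ []].
split=> [/sat_fand[hj /IH hs] i|h].
  by rewrite inE => /predU1P[->//|]; exact: hs.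
by apply/sat_fand; split; [|apply/IH => i si]; apply: h;
  rewrite inE ?eqxx ?si ?orbT.
Qed.

End connectives.

(** * Universal closure and elementary equivalence *)

(** Induction on [k]: [unlift ord0] sends the first variable to [None], which one [fall] then binds.
    Elementary equivalence compares sentences only. *)
Lemma universal_closure L k (phi : formula L 'I_k) :
  exists sigma : sentence L, forall M : structure L,
    models M sigma <-> forall v : 'I_k -> M, sat phi v.
Proof.
elim: k phi => [|k IH] phi.
  exists (frename (fun i : 'I_0 => False_rect void (notF (ltn_ord i))) phi) => M.
  rewrite /models sat_frename; split=> [h v|]; last exact.
  by congr (sat phi _): h; apply/funext => -[].
have [sigma sigmaP] :=
  IH (fall (frename (fun i : 'I_k.+1 => unlift ord0 i) phi)).
exists sigma => M; rewrite sigmaP /=; split=> [h v|h v a]; last first.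
  by rewrite sat_frename; exact: h.
have := h (v \o lift ord0) (v ord0); rewrite sat_frename.
congr (sat phi _); apply/funext => i /=.
by case: unliftP => [j|] ->.
Qed.

Section elementary_equivalence.
Context {L : language}.
Implicit Types (M N : structure L) (T : finType).

Lemma Th_sub_eq M N : Th M `<=` Th N -> Th M = Th N.
Proof.
move=> MN; apply/seteqP; split=> // sigma Ns; apply: contrapT => nMs.
exact: (MN (fnot sigma)).
Qed.

Lemma valid_transfer M N T (phi : formula L T) : Th M = Th N ->
  (forall v : T -> M, sat phi v) -> forall w : T -> N, sat phi w.
Proof.
move=> MN Mphi w.
have [sigma sigmaP] := universal_closure (frename enum_rank phi).
have /(_ (w \o enum_val)) : forall v, sat (M := N) (frename enum_rank phi) v.
  apply/sigmaP; change (Th N sigma); rewrite -MN; apply/sigmaP => v.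
  by rewrite sat_frename; exact: Mphi.
rewrite sat_frename; congr (sat phi _).
by apply/funext => t /=; rewrite enum_rankK.
Qed.

Lemma satisfiable_transfer M N T (phi : formula L T) : Th M = Th N ->
  (exists v : T -> M, sat phi v) -> exists w : T -> N, sat phi w.
Proof.
move=> MN [v Mphi]; apply: contrapT => Nphi.
have Nnphi (w : T -> N) : sat (fnot phi) w by move=> ?; apply: Nphi; exists w.
have Mnphi : sat (fnot phi) v := valid_transfer (esym MN) Nnphi v.
exact: Mnphi.
Qed.

End elementary_equivalence.

(* [v] and [w] have the same quantifier-free type. *)
Definition qfeq L (M N : structure L) (T : Type) (v : T -> M) (w : T -> N) :=
  (forall x y, v x = v y <-> w x = w y) /\
  (forall s (t : (arity s).-tuple T),
     interp M s (map_tuple v t) <-> interp N s (map_tuple w t)).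

(** * Quantifier-free equivalence and ultrahomogeneity *)

Section qfeq_theory.
Context {L : language}.
Implicit Types (M N P : structure L) (T : Type).

Lemma qfeq_sym M N T (v : T -> M) (w : T -> N) : qfeq v w -> qfeq w v.
Proof. by case=> e r; split=> *; apply: iff_sym; [exact: e|exact: r]. Qed.

Lemma qfeq_trans M N P T (v : T -> M) (w : T -> N) (u : T -> P) :
  qfeq v w -> qfeq w u -> qfeq v u.
Proof.
case=> e r [e' r']; split=> *; first exact: iff_trans (e _ _) (e' _ _).
exact: iff_trans (r _ _) (r' _ _).
Qed.

Lemma qfeq_comp M N T T' (g : T' -> T) (v : T -> M) (w : T -> N) :
  qfeq v w -> qfeq (v \o g) (w \o g).
Proof.
case=> e r; split=> [x y|s t]; first exact: e.
by have := r s (map_tuple g t); rewrite !map_tuple_comp.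
Qed.

Lemma embedding_qfeq M N T (f : M -> N) (v : T -> M) :
  embedding f -> qfeq v (f \o v).
Proof.
case=> fI fr; split=> [x y|s t]; first by split=> [/= ->//|/fI].
by rewrite fr map_tuple_comp.
Qed.

(** By [qfeq], sending [v t] to [w t] is a well-defined embedding of the range of [v]; as [v] may
    repeat points, an index [p x] is chosen for each [x]. *)
Lemma ultrahomogeneous_qfeq M (T : finType) (v w : T -> M) :
  ultrahomogeneous M -> qfeq v w ->
  exists2 g : M -> M, automorphism g & forall t, g (v t) = w t.
Proof.
move=> homM [e r].
have pickP (x : set_type (range v)) : exists t, v t = val x.
  by case: x => x /= /set_mem[t _ <-]; exists t.
pose p x := projT1 (cid (pickP x)).
have pE x : v (p x) = val x by rewrite /p; case: cid.
have [|g ga gE] := homM (range v) (w \o p) (finite_image v (@finite_finset _ _)).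
  split=> [x y /e|s t /=]; first by rewrite !pE; exact: val_inj.
  by have := r s (map_tuple p t); rewrite !map_tuple_comp (funext pE : v \o p = val).
exists g => // t.
have tv : v t \in range v by apply/mem_set; exists t.
by rewrite [LHS](gE (SigSub tv)); apply/e; rewrite pE.
Qed.

Lemma ultrahomogeneous_ext M (T : finType) (v w : T -> M) (a : M) :
  ultrahomogeneous M -> qfeq v w -> exists b, qfeq (oapp v a) (oapp w b).
Proof.
move=> homM /(ultrahomogeneous_qfeq homM)[g [_ ge] gE]; exists (g a).
rewrite (_ : oapp w (g a) = g \o oapp v a); first exact: embedding_qfeq.
by apply/funext => -[x|] //=; rewrite gE.
Qed.

End qfeq_theory.

(** * Back-and-forth between models of one theory *)

Section back_and_forth.
Context {L : language} (S : finType) (e : S -> symbol L).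
Context (e_surj : forall s, exists x, e x = s).
Implicit Types (M N : structure L) (T : finType).

Definition literal M (V : Type) (v : V -> M) (phi : formula L V) : formula L V :=
  if `[< sat phi v >] then phi else fnot phi.

Lemma sat_literal M N (V : Type) (v : V -> M) (w : V -> N) (phi : formula L V) :
  sat (literal v phi) w <-> (sat phi v <-> sat phi w).
Proof.
by rewrite /literal; case: asboolP => /= ?; tauto.
Qed.

(** With finitely many variables and symbols, all literals true of [v] fit into one conjunction,
    which describes its quantifier-free type. *)
Lemma diagram M T (v : T -> M) :
  exists phi : formula L T, forall N (w : T -> N), sat phi w <-> qfeq v w.
Proof.
pose eqs := fconj (fun p : T * T => literal v (feq p.1 p.2)) (enum {: T * T}).
pose rels := fconj (fun x : S =>
  fconj (fun t => literal v (Defs.frel (e x) t))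
    (enum {: (arity (e x)).-tuple T})) (enum S).
exists (fand eqs rels) => N w; rewrite sat_fand !sat_fconj.
split=> [[h h']|[h h']]; split.
- by move=> x y; apply/(sat_literal v w (feq x y))/(h (x, y)); rewrite mem_enum.
- move=> s; have [x <-] := e_surj s => t.
  apply/(sat_literal v w (Defs.frel (e x) t)).
  by have /sat_fconj := h' x (mem_enum _ _); apply; rewrite mem_enum.
- by move=> [x y] _; apply/sat_literal; exact: h.
- by move=> x _; apply/sat_fconj => t _; apply/sat_literal; exact: h'.
Qed.

Lemma qfeq_realized M N T (v : T -> M) : Th M = Th N ->
  exists w : T -> N, qfeq v w.
Proof.
have [phi phiP] := diagram v => MN.
have [|w /phiP] := @satisfiable_transfer L M N T phi MN; last by exists w.
by exists v; apply/phiP.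
Qed.

(** The extension property is first-order: the diagram of [v] implies that some point completes it
    to the diagram of [oapp v a]. Ultrahomogeneity makes this valid in [G], and [Th N = Th G]
    carries it to [N]. *)
Lemma back_and_forth (G M N : structure L) T (v : T -> M) (w : T -> N) (a : M) :
  ultrahomogeneous G -> Th M = Th G -> Th N = Th G ->
  qfeq v w -> exists b, qfeq (oapp v a) (oapp w b).
Proof.
move=> homG MG NG vw.
have [x vax] := qfeq_realized (oapp v a) MG.
have [phi phiP] := diagram v; have [psi psiP] := diagram (oapp v a).
suff /(_ w) : forall w : T -> N, sat (fimp phi (fexists psi)) w.
  move=> /(_ (proj2 (phiP _ _) vw)) /sat_fexists[b /psiP]; by exists b.
apply: (valid_transfer (esym NG)) => y /= /phiP vy; apply/sat_fexists.
have [|b xb] := @ultrahomogeneous_ext L G T (x \o some) y (x None) homG.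
  exact: qfeq_trans (qfeq_sym (qfeq_comp some vax)) vy.
exists b; apply/psiP; apply: qfeq_trans vax _.
by apply: qfeq_trans xb; rewrite (_ : oapp _ _ = x) //; apply/funext => -[].
Qed.

End back_and_forth.

(** * Semantic quantifier elimination *)

(** Separates, within a finite support, the bound variable from the free ones, and later the
    variables from the parameters. *)
Lemma finite_partial_factor (T : finType) (V : Type) (f : T -> option V) :
  exists (T' : finType) (g : T' -> V) (r : T -> option T'),
    forall t, f t = omap g (r t).
Proof.
have /choice[g gE] (i : {i : T | f i}) : exists x, f (val i) = Some x.
  by case: i => i /=; case: (f i) => // x _; exists x.
exists {i : T | f i}, g, insub => t.
case: insubP => [j _ tj|]; first by rewrite /= -tj gE.
by case: (f t).
Qed.

Definition qf_homogeneous L (U : structure L) : Prop :=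
  forall (T : finType) (v w : T -> U) (a : U), qfeq v w ->
    exists b, qfeq (oapp v a) (oapp w b).

(** Under [fall] the bound variable is dropped from the support; homogeneity matches each of its
    values on one side with a value on the other. *)
Lemma finite_qf_support L (U : structure L) (V : Type) (phi : formula L V) :
  qf_homogeneous U ->
  exists (T : finType) (f : T -> V), forall v w : V -> U,
    qfeq (v \o f) (w \o f) -> (sat phi v <-> sat phi w).
Proof.
move=> ext; elim: phi => {V} [V|V x y|V s t|V phi [T [f fP]] psi [T' [f' fP']]|
    V phi [T [f fP]]].
- by exists void, (of_void V).
- by exists bool, (fun b => if b then x else y) => v w [/(_ true false)].
- exists 'I_(arity s), (tnth t) => v w [_ /(_ s (ord_tuple _))] /=.
  have ordE u : map_tuple (u \o tnth t) (ord_tuple _) = map_tuple u t :> _.-tuple U.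
    by apply: eq_from_tnth => i; rewrite !tnth_map tnth_ord_tuple.
  by rewrite !ordE.
- exists (T + T')%type, (fun x => match x with inl i => f i | inr i => f' i end).
  move=> v w vw /=; have := fP _ _ (qfeq_comp inl vw).
  by have := fP' _ _ (qfeq_comp inr vw) => -> ->.
have [T' [g [r fE]]] := finite_partial_factor f.
have oappE (u : V -> U) a : oapp u a \o f = oapp (u \o g) a \o r.
  by apply/funext => t; rewrite /= fE; case: (r t).
exists T', g => v w.
suff half (v' w' : V -> U) : qfeq (v' \o g) (w' \o g) ->
    sat (fall phi) v' -> sat (fall phi) w'.
  by move=> vw; split; apply: half => //; exact: qfeq_sym.
move=> vw h b; have [a ba] := ext _ _ _ b (qfeq_sym vw).
apply/(fP (oapp v' a)); last exact: h.
by rewrite !oappE; exact/qfeq_comp/qfeq_sym.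
Qed.

(** * Saturation and the Stone topology *)

(** [saturated] speaks of complete types. An ultrafilter refining the filter of finite solution sets
    completes the partial type, and any finite part of the result holds somewhere. *)
Lemma saturated_realizes (K : Type) L (U : structure L) (A : set U) n (I : Type)
    (Phi : I -> formula L ('I_n + set_type A)) :
  saturated K U -> small K A ->
  (forall k (s : 'I_k -> I), exists a : 'I_n -> U,
     forall j, sat (Phi (s j)) (val_at a)) ->
  exists a : 'I_n -> U, forall i, sat (Phi i) (val_at a).
Proof.
move=> satU smallA fip.
pose B (s : {k & 'I_k -> I}) : set ('I_n -> U) :=
  [set a | forall j, sat (Phi (projT2 s j)) (val_at a)].
have F_proper : ProperFilter (filter_from setT B).
  apply: filter_from_proper => [|[k s] _]; last exact: fip.
  apply: filter_from_filter => [|[k s] [k' s'] _ _].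
    by exists (existT (fun k => 'I_k -> I) 0%N (fun i : 'I_0 => False_rect I (notF (ltn_ord i)))).
  exists (existT (fun k => 'I_k -> I) (k + k')%N
    (fun i => match fintype.split i with inl j => s j | inr j => s' j end)) => //.
  move=> a aP; split=> j /=.
    by have /= := aP (lshift k' j); rewrite -[lshift k' j]/(unsplit (inl j)) unsplitK.
  by have /= := aP (rshift k j); rewrite -[rshift k j]/(unsplit (inr j)) unsplitK.
have [W [W_ultra FW]] := ultraFilterLemma F_proper.
pose p : set (formula L ('I_n + set_type A)) :=
  [set psi | W [set a | sat psi (val_at a)]].
have p_complete : complete_type p.
  split=> [X finX Xp|psi]; last exact: in_ultra_setVsetC.
  suff /filter_ex[a aP] : W (\bigcap_(psi in X) [set a | sat psi (val_at a)]).
    by exists a => psi /aP.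
  have /finite_fsetP[Y XY] := (finX : finite_set (X : set {classic _})).
  rewrite XY; apply: (@filter_bigI _ {classic formula L ('I_n + set_type A)}).
  by move=> psi Ypsi; apply: Xp; rewrite XY.
have [a aP] := satU _ _ (exist _ p p_complete) smallA.
exists a => i; apply: aP; apply: FW.
exists (existT (fun k => 'I_k -> I) 1%N (fun=> i)) => //; by move=> b /(_ ord0).
Qed.

(** A basic open set of the Stone space is a finite intersection of sets [basic_clopen psi]; the
    conjunction of these [psi] is the formula sought. *)
Lemma nbhs_tp L (U : structure L) (A : set U) n (b : 'I_n -> U)
    (B : set (type_space A n)) :
  nbhs (tp A b) B ->
  exists2 psi : formula L ('I_n + set_type A), sat psi (val_at b) &
    forall b', sat psi (val_at b') -> B (tp A b').
Proof.
rewrite nbhsE => -[B0 [openO Ob] sOB].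
have [D' sD' DO] : exists2 D', D' `<=` finI_from (range (@basic_clopen L U A n)) id &
      \bigcup_(C in D') C = B0.
  exact: openO.
move: Ob; rewrite -DO => -[C D'C Cb].
have [X sX XC] := sD' _ D'C.
have /choice[g gP] (Y : set (type_space A n)) :
    exists psi, Y \in X -> Y = basic_clopen psi.
  have [YX|] := boolP (Y \in X); last by exists fbot.
  by have /set_mem[psi _ <-] := sX _ YX; exists psi.
exists (fconj g (enum_fset X)) => [|b' /sat_fconj h].
  apply/sat_fconj => Y YX; have := Cb; rewrite -XC => /(_ Y YX).
  by rewrite {1}(gP _ YX).
apply: sOB; rewrite -DO; exists C => //; rewrite -XC => Y /= YX.
by rewrite (gP _ YX); exact: h.
Qed.

(** * Keisler measures carried by countably many points *)

Lemma sat_at_fand L (U : structure L) n (phi psi : formula L ('I_n + U)) a :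
  sat_at (fand phi psi) a <-> sat_at phi a /\ sat_at psi a.
Proof. exact: sat_fand. Qed.

Lemma sat_at_for L (U : structure L) n (phi psi : formula L ('I_n + U)) a :
  sat_at (for_ phi psi) a <-> sat_at phi a \/ sat_at psi a.
Proof. exact: sat_for. Qed.

Section keisler_measures.
Context {R : realType} {L : language} {U : structure L} {n : nat}.
Context (mu : keisler_measure R U n).
Implicit Types (phi psi : formula L ('I_n + U)) (a b : 'I_n -> U).

Lemma kmeas_unsat phi : (forall a, ~ sat_at phi a) -> mu phi = 0.
Proof.
move=> nphi; have := @kmeas_additive _ _ _ _ mu phi phi.
rewrite (@kmeas_equiv _ _ _ _ mu _ phi) => [|a].
  by move=> /(_ (fun a h => nphi a h.1)); lra.
by split=> [/sat_at_for[]|/nphi].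
Qed.

Lemma kmeas_splitE phi psi :
  mu phi = mu (fand phi psi) + mu (fand phi (fnot psi)).
Proof.
rewrite -kmeas_additive => [|a [/sat_at_fand[_ h] /sat_at_fand[_ nh]]]; last exact: nh.
apply: kmeas_equiv => a; split=> [h|/sat_at_for[]/sat_at_fand[]//].
by apply/sat_at_for; have [h'|h'] := EM (sat_at psi a); [left|right];
  apply/sat_at_fand.
Qed.

Lemma kmeas_le phi psi :
  (forall a, sat_at phi a -> sat_at psi a) -> mu phi <= mu psi.
Proof.
move=> h; rewrite (kmeas_splitE psi phi).
rewrite (@kmeas_equiv _ _ _ _ mu (fand psi phi) phi) ?lerDl ?kmeas_ge0 //.
by move=> a; split=> [/sat_at_fand[]//|ha]; apply/sat_at_fand; split; [exact: h|].
Qed.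

Lemma kmeas_for_le phi psi : mu (for_ phi psi) <= mu phi + mu psi.
Proof.
rewrite (kmeas_splitE _ phi); apply: lerD; apply: kmeas_le => a /sat_at_fand[] //.
Qed.

Lemma kmeas_not_fconj_le (I : eqType) (g : I -> formula L ('I_n + U)) s :
  mu (fnot (fconj g s)) <= \sum_(i <- s) mu (fnot (g i)).
Proof.
elim: s => [|i s IH].
  by rewrite big_nil kmeas_unsat // => a h; exact: h.
rewrite big_cons; apply: (le_trans _ (lerD (lexx _) IH)).
apply: le_trans (kmeas_for_le _ _); apply: kmeas_le => a h.
apply/sat_at_for; have [gi|] := EM (sat_at (g i) a); last by left.
by right=> h'; apply: h; apply/sat_at_fand.
Qed.

Lemma kmeas_point : exists a : 'I_n -> U, True.
Proof.
apply: contrapT => h.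
have : mu ftop = 0 by apply: kmeas_unsat => a; case: h; exists a.
by rewrite kmeas_top => /eqP; rewrite oner_eq0.
Qed.

Definition fpoint a : formula L ('I_n + U) :=
  fconj (fun i => feq (inl i) (inr (a i))) (enum 'I_n).

Lemma sat_fpoint a b : sat_at (fpoint a) b <-> b = a.
Proof.
rewrite /sat_at sat_fconj; split=> [h|-> //].
by apply/funext => i; apply: (h i); rewrite mem_enum.
Qed.

Definition foutside (T : finType) (c : T -> 'I_n -> U) : formula L ('I_n + U) :=
  fconj (fun t => fnot (fpoint (c t))) (enum T).

Lemma sat_foutside (T : finType) (c : T -> 'I_n -> U) a :
  sat_at (foutside c) a <-> forall t, a <> c t.
Proof.
rewrite /sat_at sat_fconj; split=> [h t /sat_fpoint|h t _ /sat_fpoint]; last exact: h.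
by apply: h; rewrite mem_enum.
Qed.

Lemma kmeas_fand_fpoint phi a :
  mu (fand phi (fpoint a)) = mu (fpoint a) * @dirac_at R _ _ _ a phi.
Proof.
rewrite /dirac_at; case: asboolP => h.
  rewrite mulr1; apply: kmeas_equiv => b; split=> [/sat_at_fand[]//|/sat_fpoint->].
  by apply/sat_at_fand; split=> //; exact/sat_fpoint.
by rewrite mulr0; apply: kmeas_unsat => b /sat_at_fand[+ /sat_fpoint ba]; rewrite ba.
Qed.

(* The enumeration [c] may repeat points: only the first occurrence gets mass. *)
Let weight (c : nat -> 'I_n -> U) k : R :=
  if `[< exists2 j, (j < k)%N & c j = c k >] then 0 else mu (fpoint (c k)).

Let firsts (c : nat -> 'I_n -> U) N := foutside (fun k : 'I_N => c k).

Let sat_firsts c N a : sat_at (firsts c N) a <-> forall k, (k < N)%N -> a <> c k.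
Proof.
rewrite sat_foutside; split=> h k; last exact: h.
by move=> kN; exact: h (Ordinal kN).
Qed.

(** The partial sums are the part of [mu] carried by the first [N] points: either [c N] is a
    repetition and adds nothing, or its atom is disjoint from the earlier ones and additivity
    applies. *)
Let series_weightE (c : nat -> 'I_n -> U) phi N :
  series (fun k => weight c k * @dirac_at R _ _ _ (c k) phi) N =
  mu (fand phi (fnot (firsts c N))).
Proof.
elim: N => [|N IH].
  rewrite /series /= big_nil kmeas_unsat // => a /sat_at_fand[_]; apply.
  by apply/sat_firsts.
rewrite seriesSr IH /weight; case: asboolP => [[j jN cjN]|new].
  rewrite mul0r addr0; apply: kmeas_equiv => a.
  split=> /sat_at_fand[h h']; apply/sat_at_fand; split=> // /sat_firsts h''; apply: h'.
    by apply/sat_firsts => k kN; apply: h''; exact: ltnW.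
  apply/sat_firsts => k; rewrite ltnS leq_eqVlt => /predU1P[->|]; last exact: h''.
  by rewrite -cjN; exact: h''.
rewrite -kmeas_fand_fpoint -kmeas_additive; last first.
  move=> a [/sat_at_fand[_ h] /sat_at_fand[_ /sat_fpoint aN]]; apply: h.
  by apply/sat_firsts => k kN ak; apply: new; exists k; rewrite // -ak.
apply: kmeas_equiv => a; split.
  move=> /sat_at_for[] /sat_at_fand[h h']; apply/sat_at_fand; split=> // /sat_firsts h''.
    by apply: h'; apply/sat_firsts => k kN; apply: h''; exact: ltnW.
  by move/sat_fpoint: h' => h'; exact: h'' N (leqnn _) h'.
move=> /sat_at_fand[h h']; apply/sat_at_for.
have [aN|aN] := EM (a = c N); [right|left]; apply/sat_at_fand; split=> //.
  exact/sat_fpoint.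
move=> /sat_firsts h''; apply: h'; apply/sat_firsts => k.
by rewrite ltnS leq_eqVlt => /predU1P[->|]; [|exact: h''].
Qed.

Lemma trivial_of_tight_sequence (c : nat -> 'I_n -> U) :
  (forall eps : R, 0 < eps -> exists N, mu (firsts c N) < eps) ->
  trivial_measure mu.
Proof.
move=> tight; exists c, (weight c).
have cvg phi :
    series (fun k => weight c k * @dirac_at R _ _ _ (c k) phi) @ \oo --> mu phi.
  apply/cvgrPdist_lt => eps /tight[N hN].
  exists N => // N' /= NN'; rewrite series_weightE.
  (* The error at stage [N'] is the mass of [phi] outside the first [N'] points, hence at most the
     mass outside the first [N]. *)
  rewrite (kmeas_splitE phi (firsts c N')) addrK ger0_norm ?kmeas_ge0 //.
  apply: le_lt_trans hN; apply: kmeas_le => a /sat_at_fand[_ /sat_firsts h].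
  by apply/sat_firsts => k kN; apply: h; exact: leq_trans NN'.
split=> // [k|].
  rewrite /weight; case: asboolP => _; first by rewrite lexx ler01.
  by rewrite kmeas_ge0 /= -(kmeas_top mu); apply: kmeas_le => a _ h; exact: h.
rewrite -(kmeas_top mu) (_ : weight c = fun k => weight c k * dirac_at (c k) ftop).
  exact: cvg.
apply/funext => k; rewrite /dirac_at asboolT ?mulr1 // => h; exact: h.
Qed.

(** For each [k] a finite list misses mass less than [1/(k+1)]; one sequence running through all
    these lists is tight. *)
Lemma trivial_of_tight :
  (forall eps : R, 0 < eps ->
     exists (T : finType) (c : T -> 'I_n -> U), mu (foutside c) < eps) ->
  trivial_measure mu.
Proof.
move=> tight; have [a0 _] := kmeas_point.
(* The list must work for every sequence [c] through its entries, since the actual [c] is built from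
   all lists at once. *)
have /choice[s sP] (k : nat) : exists s : seq ('I_n -> U),
    forall c, (forall i, (i < size s)%N -> exists j, c j = nth a0 s i) ->
    exists N, mu (firsts c N) < k.+1%:R^-1.
  have [|T [p pk]] := tight k.+1%:R^-1; first by rewrite invr_gt0.
  exists (map p (enum T)) => c cP.
  have /choice[j jP] t : exists j, c j = p t.
    have [|j jE] := cP (index t (enum T)).
      by rewrite size_map index_mem mem_enum.
    by exists j; rewrite jE (nth_map t) ?index_mem ?mem_enum // nth_index ?mem_enum.
  exists (\max_(t : T) (j t).+1)%N; apply: le_lt_trans pk.
  apply: kmeas_le => a /sat_firsts h; apply/sat_foutside => t; rewrite -jP.
  by apply: h; exact: (leq_bigmax t).
(* The code of [(k, i)] gives entry [i] of list [k]; numbers that are not codes give the default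
   [a0]. *)
pose c m := if choice.unpickle m is Some (k, i) then nth a0 (s k) i else a0.
apply: (@trivial_of_tight_sequence c) => eps eps0.
have [k keps] := ltr_add_invr eps0; rewrite add0r in keps.
have [|N hN] := sP k c; last by exists N; exact: lt_trans keps.
by move=> i _; exists (choice.pickle (k, i)); rewrite /c choice.pickleK.
Qed.

Definition favoid (i : 'I_n) (T : finType) (v : T -> U) : formula L ('I_n + U) :=
  fconj (fun t => fnot (feq (inl i) (inr (v t)))) (enum T).

Lemma sat_favoid i (T : finType) (v : T -> U) a :
  sat_at (favoid i v) a <-> forall t, a i <> v t.
Proof.
rewrite /sat_at sat_fconj; split=> [h t|h t _]; last exact: h.
by apply: h; rewrite mem_enum.
Qed.

(** A tuple outside the product of the finite sets has a coordinate outside its own set, so a union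
    bound over coordinates applies. *)
Lemma trivial_of_tight_coordinates :
  (forall (i : 'I_n) (eps : R), 0 < eps ->
     exists (T : finType) (v : T -> U), mu (favoid i v) < eps) ->
  trivial_measure mu.
Proof.
move=> tight; apply: trivial_of_tight => eps eps0.
have [a0 _] := kmeas_point.
have /choice[k /choice[v vP]] (i : 'I_n) : exists (k : nat) (v : nat -> U),
    mu (favoid i (fun t : 'I_k => v t)) < eps / n.+1%:R.
  have [|T [v vP]] := tight i (eps / n.+1%:R); first by rewrite divr_gt0.
  exists #|T|, (fun j => oapp (fun t : 'I_#|T| => v (enum_val t)) (a0 i) (insub j)).
  apply: le_lt_trans vP.
  apply: kmeas_le => a /sat_favoid h; apply/sat_favoid => t.
  by have := h (enum_rank t); rewrite /= valK /= enum_rankK.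
pose w i (t : 'I_(k i)) := v i t.
exists {dffun forall i : 'I_n, 'I_(k i)},
  (fun (f : {dffun forall i : 'I_n, 'I_(k i)}) i => w i (f i)).
apply: (@le_lt_trans _ _ (\sum_(i <- enum 'I_n) mu (fnot (fnot (favoid i (@w i)))))).
  apply: le_trans (kmeas_not_fconj_le _ _); apply: kmeas_le => a /sat_foutside h.
  move=> /sat_fconj h'.
  have pickP (i : 'I_n) : exists t : 'I_(k i), a i = w i t.
    apply: contrapT => h''; apply: (h' i); first by rewrite mem_enum.
    by apply/sat_favoid => t ait; apply: h''; exists t.
  apply: (h [ffun i => projT1 (cid (pickP i))]); apply/funext => i.
  by rewrite ffunE; case: cid.
rewrite big_enum /=.
(* Dividing by [n.+1] rather than [n] makes this sum strictly less than [eps], also for [n = 0]. *)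
apply: (@le_lt_trans _ _ (\sum_(i < n) eps / n.+1%:R)).
  apply: ler_sum => i _; apply: le_trans (ltW (vP i)); apply: kmeas_le => a h.
  exact: contrapT.
rewrite sumr_const card_ord -[_ *+ n]mulr_natr -mulrA gtr_pMr //.
by rewrite mulrC ltr_pdivrMr // mul1r ltr_nat.
Qed.

End keisler_measures.

(** * Points with prescribed neighbours in a small set *)

Section generic_extension.
Context {L : language} {U : structure L}.
Implicit Types (C D : formula L unit) (E : formula L bool) (x y z : U).

Definition in_def C x : Prop := sat C (fun=> x).

Definition rel_def E x y : Prop := sat E (fun b : bool => if b then x else y).

(* Used with [C = D = ftop] for graphs, and with [C], [D] the two sides for
   bipartite graphs. *)
Definition generic_extension C D E : Prop :=
  (forall (T : finType) (v : T -> U) (Y : set U), Y `<=` in_def D ->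
     exists z, [/\ in_def C z, forall t, v t <> z &
                   forall t, rel_def E (v t) z <-> Y (v t)]) /\
  (forall (T : finType) (v : T -> U) z z', in_def C z -> in_def C z' ->
     (forall t, v t <> z) -> (forall t, v t <> z') ->
     (forall t, rel_def E (v t) z <-> rel_def E (v t) z') ->
     qfeq (oapp v z) (oapp v z')).

(** Compactness: the first clause of [generic_extension] meets any finitely many requirements [Phi].
    The index [None] asks for membership in [C], and [Some m] for being distinct from [m] and
    correctly related to it. *)
Lemma generic_point (K : Type) (A : set U) C D E (Y : set U) :
  saturated K U -> small K A -> generic_extension C D E -> Y `<=` in_def D ->
  exists z, [/\ in_def C z, forall m, A m -> m <> z &
                forall m, A m -> (rel_def E m z <-> Y m)].
Proof.
move=> satU smallA [ext _] YD.
pose edge (m : set_type A) : formula L ('I_1 + set_type A) :=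
  frename (fun b : bool => if b then inr m else inl ord0) E.
pose Phi (m : option (set_type A)) : formula L ('I_1 + set_type A) :=
  if m is Some m then
    fand (fnot (feq (inl ord0) (inr m)))
         (if `[< Y (val m) >] then edge m else fnot (edge m))
  else frename (fun=> inl ord0) C.
have PhiC a : sat (Phi None) (val_at a) = in_def C (a ord0).
  by rewrite sat_frename.
have PhiE m a : sat (Phi (Some m)) (val_at a) <->
    a ord0 <> val m /\ (rel_def E (val m) (a ord0) <-> Y (val m)).
  rewrite sat_fand; apply: and_iff_compat_l.
  have edgeE : sat (edge m) (val_at a) = rel_def E (val m) (a ord0).
    by rewrite sat_frename; congr sat; apply/funext => -[].
  by case: asboolP => ? /=; rewrite edgeE; tauto.
(* [z0] only fills the places of the finite tuple whose index is [None]. *)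
have [z0 _] := ext void (of_void U) Y YD.
have [k s|a aP] := @saturated_realizes K L U A 1 _ Phi satU smallA.
  have [z [Cz vz Ez]] := ext 'I_k (fun j => oapp val z0 (s j)) Y YD.
  exists (fun=> z) => j; have := Ez j; have := vz j.
  case: (s j) => [m /= mz ?|_ _]; last by rewrite PhiC.
  by apply/PhiE; split=> // /esym.
exists (a ord0); split=> [|m /mem_set Am|m /mem_set Am].
- by rewrite -PhiC.
- by have /PhiE[h _] := aP (Some (SigSub Am)); exact/nesym.
- by have /PhiE[_ h] := aP (Some (SigSub Am)).
Qed.

End generic_extension.

(** * Tightness of definable, finitely satisfiable measures *)

Section tightness.
Context {R : realType} {L : language} {U : structure L} {n : nat}.
Context (K : Type) (A : set U) (mu : keisler_measure R U n).
Context (satU : saturated K U) (homU : qf_homogeneous U).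
Context (smallA : small K A) (muA : definable_over mu A).
Context (fsA : finitely_satisfiable_in mu A).

Lemma kmeas_eq0_fs phi :
  (forall a : 'I_n -> U, (forall i, A (a i)) -> ~ sat_at phi a) -> mu phi = 0.
Proof.
move=> h; apply/eqP; rewrite eq_le kmeas_ge0 andbT leNgt; apply/negP => /fsA.
by case=> a /h.
Qed.

(** Continuity at [tp A b] yields a formula over [A], whose truth at [b'] depends only on the
    quantifier-free type of [b'] with finitely many parameters. *)
Lemma definable_continuity m (phi : formula L ('I_n + 'I_m)) (b : 'I_m -> U)
    (eps : R) : 0 < eps ->
  exists (T : finType) (v : T -> U), (forall t, A (v t)) /\
    forall b' : 'I_m -> U,
      qfeq (fun x => match x with inl i => b i | inr t => v t end)
           (fun x => match x with inl i => b' i | inr t => v t end) ->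
      `|mu (finst phi b) - mu (finst phi b')| < eps.
Proof.
move=> eps0; have [F Fcont FE] := muA phi.
have /nbhs_tp[psi psib psiP] : nbhs (tp A b) [set q | `|F (tp A b) - F q| < eps].
  by move/cvgr_dist_lt: (Fcont (tp A b)); exact.
have [T [f fP]] := finite_qf_support psi homU.
(* The parameters in the support of [psi] are collected in [T']; [r'] below redirects each index of
   the support to a variable or to one of them. *)
have [T' [g [r fE]]] := finite_partial_factor
  (fun t => match f t with inl _ => None | inr c => Some c end).
exists T', (val \o g); split=> [t|b' bb']; first exact/set_mem/(valP (g t)).
rewrite -!FE; apply: psiP.
suff bb'f : qfeq (val_at b \o f) (val_at b' \o f) by apply/(fP _ _ bb'f).
have /choice[r' r'E] t : exists y : 'I_m + T', forall c : 'I_m -> U,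
    val_at c (f t) = match y with inl i => c i | inr s => val (g s) end.
  have := fE t; case: (f t) => [i _|c]; first by exists (inl i).
  by case: (r t) => //= s [->]; exists (inr s).
have := qfeq_comp r' bb'.
by congr qfeq; apply/funext => t /=; rewrite r'E.
Qed.

(** [generic_extension] prescribes neighbours only within [D], so the bound concerns tuples whose
    [i]-th coordinate lies in [D]. *)
Lemma tight_on_definable (i : 'I_n) C D E (eps : R) :
  generic_extension (U := U) C D E -> 0 < eps ->
  exists (T : finType) (v : T -> U),
    mu (fand (frename (fun=> inl i) D) (favoid i v)) < eps.
Proof.
move=> CDE eps0.
(* [b0] is related to no point of [A], so being related to it has measure 0 by finite
   satisfiability. *)
have [b0 [Cb0 Ab0 Eb0]] := generic_point satU smallA CDE (@sub0set _ _).
pose phi : formula L ('I_n + 'I_1) :=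
  frename (fun b : bool => if b then inl i else inr ord0) E.
have phiE b a : sat_at (finst phi (fun=> b)) a = rel_def E (a i) b.
  by rewrite /sat_at !sat_frename; congr sat; apply/funext => -[].
have [T [v [Av vP]]] := definable_continuity phi (fun=> b0) eps0.
(* [b] is related to every point of [A] in [D] outside [v] and to none in [v], so it looks like [b0]
   over [v]. *)
have [b [Cb Ab Eb]] := generic_point satU smallA CDE (@subDsetl _ (in_def D) (range v)).
exists T, v.
have mub0 : mu (finst phi (fun=> b0)) = 0.
  by apply: kmeas_eq0_fs => a Aa; rewrite phiE => /Eb0; exact.
have mub : mu (finst phi (fun=> b)) < eps.
  rewrite -[ltLHS]ger0_norm ?kmeas_ge0 // -normrN -[X in `|X|]sub0r -mub0.
  apply: vP.
  have : qfeq (oapp v b0) (oapp v b).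
    apply: (proj2 CDE) => // t; [exact: Ab0|exact: Ab|].
    by rewrite Eb0 // Eb //; split=> // -[_]; case; exists t.
  move=> /(@qfeq_comp _ _ _ _ _
    (fun x : 'I_1 + T => match x with inl _ => None | inr t => Some t end)).
  by congr qfeq; apply/funext => -[].
(* The part related to [b] has measure less than [eps]; the rest has no solution in [A], hence
   measure 0. *)
rewrite (kmeas_splitE mu _ (finst phi (fun=> b))) -[ltRHS]addr0.
rewrite [X in _ + X]kmeas_eq0_fs => [|a Aa /sat_at_fand[/sat_at_fand[Da va]]].
  rewrite !addr0; apply: le_lt_trans mub.
  by apply: kmeas_le => a /sat_at_fand[].
apply; change (sat_at (finst phi (fun=> b)) a).
rewrite phiE; apply/Eb => //; split; first by move: Da; rewrite /sat_at sat_frename.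
by case=> t _ tE; apply: (proj1 (sat_favoid _ _ _) va t).
Qed.

End tightness.

(** Each coordinate lies in [D true] or [D false]; half of [eps] is spent on each, and the two
    finite tuples are joined. *)
Lemma dfs_trivial_of_generic_extensions (R : realType) (K : Type) L
    (U : structure L) (C D : bool -> formula L unit) (E : formula L bool) n
    (mu : keisler_measure R U n) :
  saturated K U -> qf_homogeneous U ->
  (forall b, generic_extension (U := U) (C b) (D b) E) ->
  (forall x : U, exists b, in_def (D b) x) ->
  Defs.dfs K mu -> trivial_measure mu.
Proof.
move=> satU homU CDE cover [A [smallA _ muA fsA]].
apply: trivial_of_tight_coordinates => i eps eps0.
have tight b := tight_on_definable satU homU smallA muA fsA i (CDE b)
  (divr_gt0 eps0 (ltr0n R 2)).
have [T [v vP]] := tight true; have [T' [v' vP']] := tight false.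
exists (T + T')%type, (fun x => match x with inl t => v t | inr t => v' t end).
rewrite [ltRHS]splitr; apply: le_lt_trans (ltrD vP vP').
apply: le_trans (kmeas_for_le _ _ _); apply: kmeas_le => a /sat_favoid h.
have [b Db] := cover (a i); apply/sat_at_for.
case: b Db => Db; [left|right]; apply/sat_at_fand; split;
  try by rewrite /sat_at sat_frename.
  by apply/sat_favoid => t; exact: (h (inl t)).
by apply/sat_favoid => t; exact: (h (inr t)).
Qed.

(** * Models of the theory of a Fraïssé limit *)

Section fraisse_limits.
Context {L : language} (S : finType) (e : S -> symbol L).
Context (e_surj : forall s, exists x, e x = s).
Context {K : structure L -> Prop} {G U : structure L}.
Context (limG : fraisse_limit K G) (UG : Th U = Th G).

Lemma fraisse_qf_homogeneous : qf_homogeneous U.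
Proof.
case: limG => _ homG _ T v w a.
exact: (back_and_forth e_surj a homG UG UG).
Qed.

(** A finite tuple of [U] has a copy in [G], whose range is a finite substructure and so lies in
    [K]. This carries universal axioms of the class over to [U]. *)
Lemma fraisse_age (T : finType) (v : T -> U) :
  exists (A : structure L) (w : T -> A),
    [/\ finite_set [set: A], K A & qfeq v w].
Proof.
case: limG => _ _ ageG.
have [w0 vw0] := qfeq_realized e_surj v UG.
have w0in t : w0 t \in range w0 by apply/mem_set; exists t.
pose w t : substructure (range w0) := SigSub (w0in t).
have finA : finite_set [set: substructure (range w0)].
  apply: (sub_finite_set _ (finite_image w (@finite_finset _ setT))).
  move=> [x xw0] _; have /set_mem[t _ tx] := xw0; exists t => //.
  exact: val_inj.
have val_emb : @embedding L (substructure (range w0)) G val.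
  by split=> //; exact: val_inj.
exists (substructure (range w0)), w; split=> //.
  by apply/ageG => //; exists val.
exact: qfeq_trans vw0 (qfeq_sym (embedding_qfeq w val_emb)).
Qed.

(** [N] embeds in [G]; back-and-forth from [G] to [U] then matches the image of [c]. *)
Lemma fraisse_extension (N : structure L) (T : finType) (v : T -> U)
    (w : T -> N) (c : N) : finite_set [set: N] -> K N -> qfeq v w ->
  exists z, qfeq (oapp v z) (oapp w c).
Proof.
case: limG => _ homG ageG finN /(ageG _ finN)[f f_emb] vw.
have [z zP] := back_and_forth e_surj (f c) homG (erefl _) UG
  (qfeq_sym (qfeq_trans vw (embedding_qfeq w f_emb))).
exists z; apply: qfeq_trans (qfeq_sym zP) _.
rewrite (_ : oapp _ _ = f \o oapp w c); first exact/qfeq_sym/embedding_qfeq.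
by apply/funext => -[].
Qed.

End fraisse_limits.

Lemma finite_option (A : Type) : finite_set [set: A] -> finite_set [set: option A].
Proof.
move=> finA; apply: (@sub_finite_set _ _ (some @` [set: A] `|` [set None])).
  by move=> [a|] _; [left; exists a|right].
by rewrite finite_setU; split; [exact: finite_image|exact: finite_set1].
Qed.

Lemma map_tuple2 (T V : Type) (v : T -> V) x y :
  map_tuple v [tuple x; y] = [tuple v x; v y].
Proof. exact: val_inj. Qed.

Lemma map_tuple1 (T V : Type) (v : T -> V) x :
  map_tuple v [tuple x] = [tuple v x].
Proof. exact: val_inj. Qed.

Lemma tuple2_eta (T : Type) (t : 2.-tuple T) : exists x y, t = [tuple x; y].
Proof.
case/tupleP: t => x t; case/tupleP: t => y t.
by exists x, y; apply: val_inj; rewrite /= (tuple0 t).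
Qed.

Lemma tuple1_eta (T : Type) (t : 1.-tuple T) : exists x, t = [tuple x].
Proof. by case/tupleP: t => x t; exists x; apply: val_inj; rewrite /= (tuple0 t). Qed.

(** * The random graph *)

Section random_graph.
Context {G U : structure graph_language}.
Context (limG : random_graph G) (UG : Th U = Th G).

Let e (x : unit) : symbol graph_language := graph_E.

Let e_surj s : exists x, e x = s.
Proof. by case: s; exists tt. Qed.

Let adj (M : structure graph_language) (x y : M) := interp M graph_E [tuple x; y].

Let qfeq_adj (M N : structure graph_language) (T : Type) (v : T -> M)
    (w : T -> N) x y : qfeq v w -> adj (v x) (v y) <-> adj (w x) (w y).
Proof. by case=> _ /(_ graph_E [tuple x; y]); rewrite !map_tuple2. Qed.

Let adj_irr (x : U) : ~ adj x x.
Proof.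
have [A [w [_ [_ irr _] vw]]] := fraisse_age e_surj limG UG (fun _ : unit => x).
by rewrite /= => /(qfeq_adj tt tt vw)/irr.
Qed.

Let adj_sym (x y : U) : adj x y -> adj y x.
Proof.
have [A [w [_ [_ _ sym] vw]]] :=
  fraisse_age e_surj limG UG (fun b : bool => if b then x else y).
by move=> /(qfeq_adj true false vw)/sym/(qfeq_adj false true vw).
Qed.

Let fE : formula graph_language bool :=
  @Defs.frel graph_language _ graph_E [tuple true; false].

Let fEP (x y : U) : rel_def fE x y = adj x y.
Proof. by rewrite /rel_def /= map_tuple2. Qed.

(** A finite graph can be extended by one vertex with arbitrary neighbours, and without loops or
    directions these neighbours fix the quantifier-free type of a new vertex. *)
Lemma random_graph_generic_extension :
  generic_extension (U := U) ftop ftop fE.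
Proof.
split=> [T v Y _|T v z z' _ _ vz vz' zz'].
  have [A [w [finA [_ irrA symA] vw]]] := fraisse_age e_surj limG UG v.
  (* Vertices of [A] outside the range of [w] are not joined to the new vertex [None]. *)
  pose nbr a := exists2 t, w t = a & Y (v t).
  pose Nadj (x y : option A) : Prop :=
    match x, y with
    | Some a, Some b => adj a b
    | Some a, None | None, Some a => nbr a
    | None, None => False
    end.
  pose N := @Structure graph_language (option A)
    (fun s t => Nadj (tnth t ord0) (tnth t ord_max)).
  have wN : qfeq w (some \o w : T -> N).
    by apply: (@embedding_qfeq _ A N); split=> [x y []//|[] t];
      have [x [y ->]] := tuple2_eta t; rewrite map_tuple2.
  have KN : finite_graph N.
    split; first exact: finite_option.
      by move=> [a|] //; exact: irrA.
    by move=> [a|] [b|] //; exact: symA.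
  have [z zP] := @fraisse_extension _ _ _ e_surj _ _ _ limG UG N T v (some \o w)
    None (finite_option finA) KN (qfeq_trans vw wN).
  exists z; split=> [h|t|t]; first exact: h.
    by move/(proj1 zP (Some t) None).
  rewrite fEP; apply: iff_trans (qfeq_adj (Some t) None zP) _.
  split=> [[t' /(proj1 vw)->]//|Yt]; by exists t.
split=> [[x|] [y|] //=|[] t].
- by split=> [/vz|/vz'].
- by split=> /esym => [/vz|/vz'].
have [x [y ->]] := tuple2_eta t; rewrite !map_tuple2.
have {}zz' t' : adj (v t') z <-> adj (v t') z' by rewrite -!fEP.
case: x y => [x|] [y|] //=.
- exact: zz'.
- by split=> /adj_sym/zz'/adj_sym.
- by split=> /adj_irr.
Qed.

Lemma random_graph_measure_trivial (R : realType) (K : Type) n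
    (mu : keisler_measure R U n) :
  saturated K U -> Defs.dfs K mu -> trivial_measure mu.
Proof.
move=> satU; apply: (@dfs_trivial_of_generic_extensions _ _ _ _
  (fun=> ftop) (fun=> ftop) fE) => //.
- exact: (fraisse_qf_homogeneous e_surj limG UG).
- by move=> _; exact: random_graph_generic_extension.
- by move=> x; exists true => h; exact: h.
Qed.

End random_graph.

(** * The random bipartite graph *)

Section random_bipartite_graph.
Context {G U : structure bipartite_language}.
Context (limG : random_bipartite_graph G) (UG : Th U = Th G).

Let e (x : option bool) : symbol bipartite_language :=
  if x is Some b then if b then bip_P else bip_Q else bip_E.

Let e_surj s : exists x, e x = s.
Proof. by case: s; [exists None|exists (Some true)|exists (Some false)]. Qed.

Let adj (M : structure bipartite_language) (x y : M) :=
  interp M bip_E [tuple x; y].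

Let side (M : structure bipartite_language) (b : bool) (x : M) :=
  if b then interp M bip_P [tuple x] else interp M bip_Q [tuple x].

Let qfeq_adj (M N : structure bipartite_language) (T : Type) (v : T -> M)
    (w : T -> N) x y : qfeq v w -> adj (v x) (v y) <-> adj (w x) (w y).
Proof. by case=> _ /(_ bip_E [tuple x; y]); rewrite !map_tuple2. Qed.

Let qfeq_side (M N : structure bipartite_language) (T : Type) (v : T -> M)
    (w : T -> N) b x : qfeq v w -> side b (v x) <-> side b (w x).
Proof.
case=> _ r; have := r bip_P [tuple x]; have := r bip_Q [tuple x].
by rewrite !map_tuple1; case: b.
Qed.

(** The axioms of [finite_bipartite_graph] without finiteness, so that they can be stated for
    [U]. *)
Let bipartite (M : structure bipartite_language) :=
  [/\ forall x : M, (side true x \/ side false x) /\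
                    ~ (side true x /\ side false x),
      forall x y : M, adj x y -> adj y x &
      forall x y : M, adj x y -> side true x /\ side false y \/
                                 side false x /\ side true y].

Let bipartiteU : bipartite U.
Proof.
have age T := @fraisse_age _ _ _ e_surj _ _ _ limG UG T.
split=> [x|x y|x y].
- have [A [w [_ [_ h _ _] vw]]] := age _ (fun _ : unit => x).
  have sideE b := qfeq_side b tt vw.
  by rewrite !sideE; exact: h.
- have [A [w [_ [_ _ h _] vw]]] := age _ (fun b : bool => if b then x else y).
  by move=> /(qfeq_adj true false vw)/h/(qfeq_adj false true vw).
- have [A [w [_ [_ _ _ h] vw]]] := age _ (fun b : bool => if b then x else y).
  have xE b := qfeq_side b true vw; have yE b := qfeq_side b false vw.
  by rewrite !xE !yE => /(qfeq_adj true false vw)/h.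
Qed.

Let side_negb (M : structure bipartite_language) b (x : M) :
  bipartite M -> side (~~ b) x <-> ~ side b x.
Proof. by case=> /(_ x) h _ _; case: b => /=; tauto. Qed.

Let adj_negb (M : structure bipartite_language) b (x y : M) :
  bipartite M -> adj x y -> side b y -> side (~~ b) x.
Proof.
by move=> bM; rewrite side_negb //; case: bM => h _ h' /h'; have := h x; have := h y;
  case: b; tauto.
Qed.

Let fside (b : bool) : formula bipartite_language unit :=
  if b then @Defs.frel bipartite_language _ bip_P [tuple tt]
  else @Defs.frel bipartite_language _ bip_Q [tuple tt].

Let fsideP b (x : U) : in_def (fside b) x = side b x.
Proof. by case: b; rewrite /in_def /= map_tuple1. Qed.

Let fE : formula bipartite_language bool :=
  @Defs.frel bipartite_language _ bip_E [tuple true; false].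

Let fEP (x y : U) : rel_def fE x y = adj x y.
Proof. by rewrite /rel_def /= map_tuple2. Qed.

(** The new vertex goes on side [b] and [Y] lies on the other side, so the extension stays
    bipartite. Among new vertices of side [b], the neighbours in [v] fix the quantifier-free type
    over [v]. *)
Lemma random_bipartite_graph_generic_extension b :
  generic_extension (U := U) (fside b) (fside (~~ b)) fE.
Proof.
split=> [T v Y YD|T v z z'].
  have [A [w [finA [_ partA symA bipA] vw]]] := fraisse_age e_surj limG UG v.
  pose nbr a := exists2 t, w t = a & Y (v t).
  have nbr_side a : nbr a -> side (~~ b) a.
    by case=> t <- /YD; rewrite fsideP => /(qfeq_side _ t vw).
  pose Nadj (x y : option A) : Prop :=
    match x, y with
    | Some a, Some b => adj a b
    | Some a, None | None, Some a => nbr a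
    | None, None => False
    end.
  pose Nside c (x : option A) : Prop := if x is Some a then side c a else c = b.
  pose N := @Structure bipartite_language (option A)
    (fun s => match s with
      | bip_E => fun t => Nadj (tnth t ord0) (tnth t ord_max)
      | bip_P => fun t => Nside true (tnth t ord0)
      | bip_Q => fun t => Nside false (tnth t ord0)
      end).
  have wN : qfeq w (some \o w : T -> N).
    apply: (@embedding_qfeq _ A N); split=> [x y []//|[] t].
    + by have [x [y ->]] := tuple2_eta t; rewrite map_tuple2.
    + by have [x ->] := tuple1_eta t; rewrite map_tuple1.
    + by have [x ->] := tuple1_eta t; rewrite map_tuple1.
  have KN : finite_bipartite_graph N.
    split; first exact: finite_option.
    + move=> [a|]; first exact: partA.
      by rewrite /= /Nside /=; case: (b); split; [left|case|right|case].
    + by move=> [x|] [y|] //; exact: symA.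
    + move=> [x|] [y|] //=; first exact: bipA.
      * by move/nbr_side; rewrite /Nside /side /=; case: (b); tauto.
      * by move/nbr_side; rewrite /Nside /side /=; case: (b); tauto.
  have [z zP] := @fraisse_extension _ _ _ e_surj _ _ _ limG UG N T v (some \o w)
    None (finite_option finA) KN (qfeq_trans vw wN).
  exists z; split=> [|t|t].
  - rewrite fsideP; apply/(qfeq_side b None zP).
    by rewrite /side /=; case: ifP; rewrite /Nside /=; case: (b).
  - by move/(proj1 zP (Some t) None).
  rewrite fEP; apply: iff_trans (qfeq_adj (Some t) None zP) _.
  split=> [[t' /(proj1 vw)->]//|Yt]; by exists t.
rewrite !fsideP => bz bz' vz vz' zz'.
have [partU symU bipU] := bipartiteU.
have sideE c x : side c (oapp v z x) <-> side c (oapp v z' x).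
  case: x => //=; have [->//|/eqP cb] := eqVneq c b.
  have -> : c = ~~ b by case: (b) c cb => -[].
  by rewrite !side_negb.
split=> [[x|] [y|] //=|s t].
- by split=> [/vz|/vz'].
- by split=> /esym => [/vz|/vz'].
case: s t => t.
- have [x [y ->]] := tuple2_eta t; rewrite !map_tuple2.
  have {}zz' t' : adj (v t') z <-> adj (v t') z' by rewrite -!fEP.
  case: x y => [x|] [y|] //=.
  + exact: zz'.
  + by split=> /symU/zz'/symU.
  (* A loop would put the vertex on both sides. *)
  + by split=> h; [have := adj_negb bipartiteU h bz|have := adj_negb bipartiteU h bz'];
      rewrite side_negb.
- by have [x ->] := tuple1_eta t; rewrite !map_tuple1; exact: (sideE true x).
- by have [x ->] := tuple1_eta t; rewrite !map_tuple1; exact: (sideE false x).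
Qed.

Lemma random_bipartite_graph_measure_trivial (R : realType) (K : Type) n
    (mu : keisler_measure R U n) :
  saturated K U -> Defs.dfs K mu -> trivial_measure mu.
Proof.
move=> satU; apply: (@dfs_trivial_of_generic_extensions _ _ _ _
  fside (fun b => fside (~~ b)) fE) => //.
- exact: (fraisse_qf_homogeneous e_surj limG UG).
- exact: random_bipartite_graph_generic_extension.
(* The covering sets are the opposite sides, so a point of [P] is covered by the index [false]. *)
- move=> x; have [/(_ x)[[Px|Qx] _] _ _] := bipartiteU.
    by exists false; rewrite fsideP.
  by exists true; rewrite fsideP.
Qed.

End random_bipartite_graph.

Theorem theorem4p9 (R : realType) :
  (forall G : structure graph_language,
     random_graph G -> dfs_trivial R (Th G)) /\
  (forall G : structure bipartite_language,
     random_bipartite_graph G -> dfs_trivial R (Th G)).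
Proof.
split=> G limG K U [_ GU satU _] n _ mu.
  exact: (random_graph_measure_trivial limG (esym (Th_sub_eq GU)) satU).
exact: (random_bipartite_graph_measure_trivial limG (esym (Th_sub_eq GU)) satU).
Qed.
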